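(* Let $\mathbf{K}$ be a field of characteristic $0$. In the class of commutative (not necessarily associative) $\mathbf{K}$-algebras, the minus-Tortken identity $$(ab)(cd)-(ad)(cb)=-(a,b,c)\,d+(a,d,c)\,b,\qquad (a,b,c)=a(bc)-(ab)c,$$ and the weak right-commutativity identity $$((ab)c)d=((ab)d)c$$ are independent: the weak right-commutativity identity is not a consequence of commutativity and the minus-Tortken identity, and the minus-Tortken identity is not a consequence of commutativity and the weak right-commutativity identity.
   Context: An identity $g$ is a consequence of a set of identities if every $\mathbf{K}$-algebra satisfying all identities in the set also satisfies $g$. Thus the claim asserts that there is a commutative $\mathbf{K}$-algebra satisfying the minus-Tortken identity but not weak right-commutativity, and a commutative $\mathbf{K}$-algebra satisfying weak right-commutativity but not the minus-Tortken identity. *)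

(* Defs.v *)
From mathcomp Require Import all_boot all_algebra.

Set Implicit Arguments.
Unset Strict Implicit.
Unset Printing Implicit Defensive.

Import GRing.Theory.

(* A K-algebra is a K-vector space with a bilinear product: no associativity,
   commutativity or unit is required. *)
Record nalgebra (K : fieldType) := NAlgebra {
  nalg_sort :> lmodType K;
  nalg_mul : {bilinear nalg_sort -> nalg_sort -> nalg_sort}%R
}.

(* Terms denoting nonassociative noncommutative polynomials over K in the
   variables NVar 0, NVar 1, ...; NMul is a formal product, so distinct
   bracketings are distinct terms. *)
Inductive napoly (K : Type) : Type :=
| NVar of nat
| NAdd of napoly K & napoly K
| NOpp of napoly K
| NScale of K & napoly K
| NMul of napoly K & napoly K.

Arguments NVar {K} _.

Declare Scope napoly_scope.
Delimit Scope napoly_scope with NA.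
Bind Scope napoly_scope with napoly.
Notation "f + g" := (NAdd f g) : napoly_scope.
Notation "- f" := (NOpp f) : napoly_scope.
Notation "f - g" := (NAdd f (NOpp g)) : napoly_scope.
Notation "f * g" := (NMul f g) : napoly_scope.

Fixpoint naeval (K : fieldType) (A : nalgebra K) (v : nat -> A)
    (f : napoly K) : A :=
  match f with
  | NVar i => v i
  | NAdd f g => (naeval v f + naeval v g)%R
  | NOpp f => (- naeval v f)%R
  | NScale k f => (k *: naeval v f)%R
  | NMul f g => nalg_mul A (naeval v f) (naeval v g)
  end.

(* The formal equation naid_lhs = naid_rhs. *)
Record naidentity (K : Type) := NAIdentity {
  naid_lhs : napoly K;
  naid_rhs : napoly K
}.

Notation "f =~ g" := (NAIdentity f%NA g%NA)
  (at level 70, no associativity) : napoly_scope.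
Bind Scope napoly_scope with naidentity.

Definition satisfies (K : fieldType) (A : nalgebra K) (g : naidentity K) :
    Prop :=
  forall v : nat -> A, naeval v (naid_lhs g) = naeval v (naid_rhs g).

Definition consequence (K : fieldType) (S : naidentity K -> Prop)
    (g : naidentity K) : Prop :=
  forall A : nalgebra K, (forall h, S h -> satisfies A h) -> satisfies A g.

Definition idpair (K : Type) (g h : naidentity K) : naidentity K -> Prop :=
  fun e => e = g \/ e = h.

Definition nassociator (K : Type) (a b c : napoly K) : napoly K :=
  (a * (b * c) - (a * b) * c)%NA.

Definition commutativity (K : Type) : naidentity K :=
  let a := NVar 0 in let b := NVar 1 in
  (a * b =~ b * a)%NA.

Definition minus_tortken (K : Type) : naidentity K :=
  let a := NVar 0 in let b := NVar 1 in
  let c := NVar 2 in let d := NVar 3 in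
  ((a * b) * (c * d) - (a * d) * (c * b)
     =~ - (nassociator a b c * d) + nassociator a d c * b)%NA.

Definition weak_right_commutativity (K : Type) : naidentity K :=
  let a := NVar 0 in let b := NVar 1 in
  let c := NVar 2 in let d := NVar 3 in
  (((a * b) * c) * d =~ ((a * b) * d) * c)%NA.

(* Main.v *)
(** In dimension two over [K], the product [x^2 = y], [xy = x], [y^2 = 0] is
    minus-Tortken (both sides of that identity are skew-symmetric in [a, c] and
    in [b, d], so only [a = b = x], [c = d = y] matters), while
    [((xx)x)y = x] and [((xx)y)x = 0].

    Conversely, a product [ab = B(a, b) u] with [B] a symmetric form is always
    weakly right-commutative, as [((ab)c)d = B(a,b) B(u,c) B(u,d) u].  With
    [B] the standard form on [K^3] and [u = e_1], the minus-Tortken identity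
    fails at [a = b = e_2], [c = d = e_3]. *)
Require Import Defs.
From HB Require Import structures.
From mathcomp Require Import all_boot all_algebra.
From mathcomp Require Import ring.

Import GRing.Theory.
Local Open Scope ring_scope.

Section Counterexamples.
Variable K : fieldType.

(** The pair [(s, t)] stands for [s x + t y]. *)
Definition plane_mul (a b : K^o * K^o) : K^o * K^o :=
  (a.1 * b.2 + a.2 * b.1, a.1 * b.1).

Lemma plane_mul_is_bilinear : bilinear_for *:%R *:%R plane_mul.
Proof.
(* On [K^o], unfolding [GRing.scale] turns scaling into the product of [K], within reach of
   [ring]. *)
by split=> [a | a] k b c; congr pair; rewrite /= /GRing.scale /=; ring.
Qed.

HB.instance Definition _ :=
  bilinear_isBilinear.Build K (K^o * K^o)%type (K^o * K^o)%type
    (K^o * K^o)%type *:%R *:%R plane_mul plane_mul_is_bilinear.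

Definition plane_alg : nalgebra K := @NAlgebra K _ plane_mul.

Definition space_mul (a b : K^o * K^o * K^o) : K^o * K^o * K^o :=
  (a.1.1 * b.1.1 + a.1.2 * b.1.2 + a.2 * b.2, 0, 0).

Lemma space_mul_is_bilinear : bilinear_for *:%R *:%R space_mul.
Proof.
by split=> [a | a] k b c; congr (_, _, _); rewrite /= /GRing.scale /=; ring.
Qed.

HB.instance Definition _ :=
  bilinear_isBilinear.Build K (K^o * K^o * K^o)%type (K^o * K^o * K^o)%type
    (K^o * K^o * K^o)%type *:%R *:%R space_mul space_mul_is_bilinear.

Definition space_alg : nalgebra K := @NAlgebra K _ space_mul.

Lemma plane_alg_commutative : satisfies plane_alg (commutativity K).
Proof. by move=> v; congr pair; rewrite /=; ring. Qed.

Lemma plane_alg_minus_tortken : satisfies plane_alg (minus_tortken K).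
(* Each component is a polynomial identity in the eight coordinates of [a, b, c, d]. *)
Proof. by move=> v; congr pair; rewrite /=; ring. Qed.

Lemma plane_alg_not_weak_right_commutative :
  ~ satisfies plane_alg (weak_right_commutativity K).
Proof.
(* With [a = b = c = x] and [d = y], the [x]-coordinates give [1 = 0]. *)
move=> /(_ (fun i => if (i < 3)%N then (1, 0) else (0, 1))) /(congr1 fst) /=.
rewrite !(mulr0, mul0r, mulr1, addr0, add0r) => /eqP.
by rewrite oner_eq0.
Qed.

Lemma space_alg_commutative : satisfies space_alg (commutativity K).
Proof. by move=> v; congr (_, _, _); rewrite /=; ring. Qed.

Lemma space_alg_weak_right_commutative :
  satisfies space_alg (weak_right_commutativity K).
Proof. by move=> v; congr (_, _, _); rewrite /=; ring. Qed.

Lemma space_alg_not_minus_tortken : ~ satisfies space_alg (minus_tortken K).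
Proof.
(* Here [(ab)(cd) = e_1 e_1 = e_1], while [(ad)(cb)] and both associator terms vanish. *)
move=> /(_ (fun i => if (i < 2)%N then (0, 1, 0) else (0, 0, 1))).
move=> /(congr1 (fun a => a.1.1)) /=.
rewrite !(mulr0, mul0r, mulr1, addr0, add0r, oppr0) => /eqP.
by rewrite oner_eq0.
Qed.

End Counterexamples.

Theorem mainTheorem5 (K : fieldType) (charK0 : [pchar K]%R =i pred0) :
  ~ consequence (idpair (commutativity K) (minus_tortken K))
      (weak_right_commutativity K) /\
  ~ consequence (idpair (commutativity K) (weak_right_commutativity K))
      (minus_tortken K).
Proof.
split=> cons.
  apply: (@plane_alg_not_weak_right_commutative K); apply: cons => _ [] ->.
    exact: plane_alg_commutative.
  exact: plane_alg_minus_tortken.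
apply: (@space_alg_not_minus_tortken K); apply: cons => _ [] ->.
  exact: space_alg_commutative.
exact: space_alg_weak_right_commutative.
Qed.
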